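(* Let $M$ be a first order model and let $X$ and $Y$ be teams. Then \begin{enumerate} \item $M \models_{X \rightarrow Y} \epsilon$ if and only if $X = Y$; \item $M \models_{X \rightarrow Y} \sharp v$ if and only if there exists a $F$ such that $Y = X[F/v]$; \item $M \models_{X \rightarrow Y} \sharp v / W$ if and only if there exists a $F$, independent on $W$, such that $Y = X[F/v]$; \item $M \models_{X \rightarrow Y} ~! v$ if and only if $Y = X[M/v]$; \item $M \models_{X \rightarrow Y} \gamma_1;\gamma_2$ if and only if there exists a $Z$ such that $M \models_{X \rightarrow Z} \gamma_1$ and $M \models_{Z \rightarrow Y} \gamma_2$; \item $M \models_{X \rightarrow Y} \gamma_1 \cup \gamma_2$ if and only if there exist $X_1$, $X_2$, $Y_1$ and $Y_2$ such that $M \models_{X_1 \rightarrow Y_1} \gamma_1$, $M \models_{X_2 \rightarrow Y_2} \gamma_2$, $X_1 \cup X_2 = X$ and $Y_1 \cup Y_2 = Y$; \item $M \models_{X \rightarrow Y} \phi?$ if and only if $M \models_X \phi$ and $X = Y$; \item $M \models_{X \rightarrow Y} \gamma^*$ if and only if there exists a $n \in \mathbb N$ and $Z_1, Z_2, \ldots Z_n$ such that $Z_1 = X$, $Z_n = Y$, and for all $i=1 \ldots n-1$, $M \models_{Z_i \rightarrow Z_{i+1}} \gamma$. \end{enumerate} Furthermore, let $M$ be a first order model, let $\gamma$ be a game formula over it and let $\phi$ be a belief formula over it. Then, for all teams $X$, $M \models_X \langle \gamma\rangle \phi$ if and only if there exists a $Y$ such that $M \models_{X \rightarrow Y} \gamma$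 and $M \models_Y \phi$.
   Context: Fix a nonempty set of team variables; for a first order model $M$, an assignment is a function from the team variables to $\mathrm{dom}(M)$, and a team is a set of assignments. A transition on $M$ is a partial function $\tau$ from assignments to nonempty sets of assignments; its precondition $\mathrm{pre}(\tau)$ is its domain and its postcondition $\mathrm{post}(\tau)$ is the union of its range; one writes $\tau: X \rightarrow Y$ when $\mathrm{pre}(\tau)=X$, $\mathrm{post}(\tau)=Y$. Concatenation: for $\mathrm{post}(\tau)=\mathrm{pre}(\tau')$, $(\tau\circ\tau')(s)=\bigcup\{\tau'(s'): s'\in\tau(s)\}$. Union $\tau_0\cup\tau_1$ has precondition $\mathrm{pre}(\tau_0)\cup\mathrm{pre}(\tau_1)$ and maps $s$ to $\tau_0(s)$, $\tau_1(s)$, or $\tau_0(s)\cup\tau_1(s)$ according to which preconditions contain $s$. Game formulas $\gamma$ are built from $\epsilon$, $\sharp v$ (existential assignment), $!v$ (universal assignment), $\gamma;\gamma$, $\gamma\cup\gamma$, tests $\phi?$ (with $\phi$ a belief formula), iteration $\gamma^*$, and hiding $\gamma/W$ ($W$ a set of team variables); belief formulas include first-order literals, $\top$, $\sim$, $\vee$, $\exists p$ over parameter variables, and $\langle\gamma\rangle\phi$. The interpretation $\|\gamma\|_M$ is a set of transitions: $\|\epsilon\|_M$ contains, for every team $X$, the identity $X\to X$; $\|\sharp v\|_M$ contains, for every team $X$ and every function $F$ from $X$ to nonempty subsets of $\mathrm{dom}(M)$, the transition $s\mapsto s[F/v]=\{s[m/v]: m\in F(s)\}$ with postcondition $X[F/v]=\bigcup_{s\in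 X}s[F/v]$; $\|!v\|_M$ contains, for every $X$, $s\mapsto s[M/v]=\{s[m/v]: m\in\mathrm{dom}(M)\}$ with postcondition $X[M/v]$; $\|\gamma;\gamma'\|_M$ contains $\tau\circ\tau'$ for $\tau\in\|\gamma\|_M$, $\tau'\in\|\gamma'\|_M$ with matching post/preconditions; $\|\gamma_0\cup\gamma_1\|_M$ contains $\tau_0\cup\tau_1$ for $\tau_i\in\|\gamma_i\|_M$; $\|\phi?\|_M$ contains the identity on $X$ whenever $X$ satisfies $\phi$ ($M\models_X\phi$); $\|\gamma/W\|_M$ contains those $\tau\in\|\gamma\|_M$ that are independent on $W$, i.e. $s\equiv_W s'$ (agreement on all variables outside $W$) implies $\tau(s)=\tau(s')$ (for $\sharp v/W$ this amounts to $F$ being independent on $W$); $\tau: X\to Y\in\|\gamma^*\|_M$ iff $\tau=\tau_{\epsilon,X}\circ\tau_0\circ\cdots\circ\tau_{n-1}$ for some $n\in\mathbb N$ and $\tau_i\in\|\gamma\|_M$. A team $X$ satisfies $\langle\gamma\rangle\phi$ iff some $\tau: X\to Y$ in $\|\gamma\|_M$ has $M\models_Y\phi$. Transition semantics: $M \models_{X \rightarrow Y} \gamma$ iff there exists $\tau\in\|\gamma\|_M$ with $\mathrm{pre}(\tau)=X$ and $\mathrm{post}(\tau)=Y$. The theorem is stated for Transition Logic: the sublanguage with no parallel composition operator and in which the variable hiding operator is applied only to game formulas of the form $\sharp v$.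
   Formalization: Hiding ♯v/W is interpreted by requiring the choice function F to be independent on W, rather than τ(s)=τ(s') whenever s and s' agree outside W; under the latter clause 3 fails when two assignments in X differ only at some w in W other than v. *)

(* Defs.v *)
From mathcomp Require Import all_boot.
From mathcomp Require Import boolp classical_sets.

Set Implicit Arguments.
Unset Strict Implicit.
Unset Printing Implicit Defensive.

Local Open Scope classical_set_scope.

Record signature := Signature {
  fsym : Type;
  farity : fsym -> nat;
  rsym : Type;
  rarity : rsym -> nat }.

Record model (Sg : signature) := Model {
  dom :> Type;
  dom_inhabited : inhabited dom;
  finterp : forall f : fsym Sg, ('I_(farity f) -> dom) -> dom;
  rinterp : forall r : rsym Sg, ('I_(rarity r) -> dom) -> Prop }.

Definition update (K : eqType) (D : Type) (s : K -> D) (k : K) (d : D) : K -> D :=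
  fun x => if x == k then d else s x.

Section Transitions.
Variables (V : eqType) (D : Type).

Definition assignment : Type := V -> D.
Definition team : Type := set assignment.

(* A partial function from assignments to nonempty sets of assignments: the
   value set0 at s encodes that the transition is undefined at s. *)
Definition transition : Type := assignment -> set assignment.

Definition pre (tau : transition) : team := [set s | tau s !=set0].
Definition post (tau : transition) : team := \bigcup_(s in pre tau) tau s.
Definition arrow (tau : transition) (X Y : team) : Prop :=
  pre tau = X /\ post tau = Y.

(* Only meaningful when post tau = pre tau', which is required at each use. *)
Definition tconcat (tau tau' : transition) : transition :=
  fun s => \bigcup_(s' in tau s) tau' s'.

(* As undefined values are empty, this is the three-case definition of the
   union according to which of the preconditions contain s. *)
Definition tunion (tau tau' : transition) : transition :=
  fun s => tau s `|` tau' s.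

Definition tid (X : team) : transition := fun s => [set t | X s /\ t = s].

(* F restricted to X is a function from X to nonempty subsets of the domain;
   the values of F outside X are never used. *)
Definition choice_on (X : team) (F : assignment -> set D) : Prop :=
  forall s, X s -> F s !=set0.

Definition equiv_outside (W : set V) (s s' : assignment) : Prop :=
  forall x, ~ W x -> s x = s' x.

Definition independent_on (X : team) (W : set V) (F : assignment -> set D) : Prop :=
  forall s s', X s -> X s' -> equiv_outside W s s' -> F s = F s'.

Definition supplement1 (s : assignment) (A : set D) (v : V) : set assignment :=
  [set update s v m | m in A].

Definition supplement (X : team) (F : assignment -> set D) (v : V) : team :=
  \bigcup_(s in X) supplement1 s (F s) v.

Definition duplicate (X : team) (v : V) : team :=
  \bigcup_(s in X) supplement1 s setT v.

Definition tassign (X : team) (F : assignment -> set D) (v : V) : transition :=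
  fun s => [set t | X s /\ supplement1 s (F s) v t].

Definition tall (X : team) (v : V) : transition :=
  fun s => [set t | X s /\ supplement1 s setT v t].

Definition int_eps : set transition := [set tau | exists X, tau = tid X].

Definition int_some (v : V) : set transition :=
  [set tau | exists X F, choice_on X F /\ tau = tassign X F v].

(* Independence on W is imposed on the choice function F. Requiring instead
   tau s = tau s' whenever s and s' agree outside W would exclude every
   transition s |-> s[F/v] whose team contains two such assignments that differ
   on some w <> v, since s[m/v] keeps the value of s at w. *)
Definition int_some_hide (v : V) (W : set V) : set transition :=
  [set tau | exists X F,
     [/\ choice_on X F, independent_on X W F & tau = tassign X F v]].

Definition int_all (v : V) : set transition :=
  [set tau | exists X, tau = tall X v].

Definition int_seq (G G' : set transition) : set transition :=
  [set tau | exists tau1 tau2,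
     [/\ G tau1, G' tau2, post tau1 = pre tau2 & tau = tconcat tau1 tau2]].

Definition int_union (G G' : set transition) : set transition :=
  [set tau | exists tau1 tau2, [/\ G tau1, G' tau2 & tau = tunion tau1 tau2]].

Definition int_test (S : set team) : set transition :=
  [set tau | exists X, S X /\ tau = tid X].

(* The n-th iterate is the set of all tid X o tau_0 o ... o tau_(n-1). *)
Definition int_star (G : set transition) : set transition :=
  [set tau | exists n : nat, iter n (fun H => int_seq H G) int_eps tau].

End Transitions.

Section Syntax.
(* V: team variables; P: parameter variables *)
Variables (Sg : signature) (V P : eqType).

Inductive term : Type :=
| TVar (v : V)
| TPar (p : P)
| TFun (f : fsym Sg) (ts : 'I_(farity f) -> term).

Inductive literal : Type :=
| LRel (r : rsym Sg) (ts : 'I_(rarity r) -> term)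
| LNotRel (r : rsym Sg) (ts : 'I_(rarity r) -> term)
| LEq (t1 t2 : term)
| LNeq (t1 t2 : term).

(* Hiding is applied to existential assignments only: GSomeHide v W is #v/W. *)
Inductive game : Type :=
| GEps
| GSome (v : V)
| GSomeHide (v : V) (W : set V)
| GAll (v : V)
| GSeq (g1 g2 : game)
| GUnion (g1 g2 : game)
| GTest (phi : belief)
| GStar (g : game)
with belief : Type :=
| BLit (l : literal)
| BTop
| BNeg (phi : belief)
| BOr (phi psi : belief)
| BEx (p : P) (phi : belief)
| BDia (g : game) (phi : belief).

End Syntax.

Arguments TVar {Sg V P}.
Arguments TPar {Sg V P}.
Arguments TFun {Sg V P}.
Arguments LRel {Sg V P}.
Arguments LNotRel {Sg V P}.
Arguments LEq {Sg V P}.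
Arguments LNeq {Sg V P}.
Arguments GEps {Sg V P}.
Arguments GSome {Sg V P}.
Arguments GSomeHide {Sg V P}.
Arguments GAll {Sg V P}.
Arguments BTop {Sg V P}.

Section Semantics.
Variables (Sg : signature) (V P : eqType) (M : model Sg).

(* rho gives the values in M of the free parameters, so a formula together with
   rho is a formula with parameters from M. *)
Fixpoint eval (rho : P -> M) (s : assignment V M) (t : term Sg V P) : M :=
  match t with
  | TVar v => s v
  | TPar p => rho p
  | TFun f ts => finterp (fun i => eval rho s (ts i))
  end.

Definition lit_holds (rho : P -> M) (s : assignment V M) (l : literal Sg V P) : Prop :=
  match l with
  | LRel r ts => rinterp (fun i => eval rho s (ts i))
  | LNotRel r ts => ~ rinterp (fun i => eval rho s (ts i))
  | LEq t1 t2 => eval rho s t1 = eval rho s t2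
  | LNeq t1 t2 => eval rho s t1 <> eval rho s t2
  end.

(* Negation and disjunction are Boolean on teams; literals are flat. *)
Fixpoint interp (rho : P -> M) (g : game Sg V P) {struct g} : set (transition V M) :=
  match g with
  | GEps => @int_eps V M
  | GSome v => @int_some V M v
  | GSomeHide v W => @int_some_hide V M v W
  | GAll v => @int_all V M v
  | GSeq g1 g2 => int_seq (interp rho g1) (interp rho g2)
  | GUnion g1 g2 => int_union (interp rho g1) (interp rho g2)
  | GTest phi => int_test [set X | sat rho X phi]
  | GStar g1 => int_star (interp rho g1)
  end
with sat (rho : P -> M) (X : team V M) (phi : belief Sg V P) {struct phi} : Prop :=
  match phi with
  | BLit l => forall s, X s -> lit_holds rho s l
  | BTop => True
  | BNeg psi => ~ sat rho X psi
  | BOr psi1 psi2 => sat rho X psi1 \/ sat rho X psi2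
  | BEx p psi => exists m : M, sat (update rho p m) X psi
  | BDia g psi => exists tau Y, [/\ interp rho g tau, arrow tau X Y & sat rho Y psi]
  end.

Definition trans_sat (rho : P -> M) (X Y : team V M) (g : game Sg V P) : Prop :=
  exists2 tau, interp rho g tau & arrow tau X Y.

End Semantics.

(* Main.v *)
(* The quantifier over transitions commutes with each constructor because the
   precondition and postcondition of a compound transition are determined by
   those of its parts; for concatenation, the intermediate team is the common
   value of the postcondition of the first part and the precondition of the
   second. *)

Require Import Defs.
From mathcomp Require Import all_boot.
From mathcomp Require Import boolp classical_sets.

Local Open Scope classical_set_scope.

Section Arrows.
Context {V : eqType} {D : Type}.
Implicit Types (tau : transition V D) (G : set (transition V D)) (X Y Z : team V D).

(** This frees [trans_sat] from the syntax: with [interp rho g] for [G] the two agree by conversion,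
    so each clause can be proved for arbitrary sets of transitions. *)
Definition reaches G X Y : Prop := exists2 tau, G tau & arrow tau X Y.

(** The common shape of [tid], [tassign] and [tall]. Since an empty value encodes undefinedness,
    nonemptiness of [f] on [X] is what makes the precondition all of [X]. *)
Lemma arrow_restrict X (f : assignment V D -> set (assignment V D)) :
  (forall s, X s -> f s !=set0) ->
  arrow (fun s => [set t | X s /\ f s t]) X (\bigcup_(s in X) f s).
Proof.
move=> f0; split; apply/seteqP; split.
- by move=> s [t []].
- by move=> s Xs; have [t fst] := f0 s Xs; exists t.
- by move=> t [s _ [Xs fst]]; exists s.
- by move=> t [s Xs fst]; exists s => //; exists t.
Qed.

Lemma arrow_tid X : arrow (tid X) X X.
Proof.
have := @arrow_restrict X (fun s => [set s]).
(* The union of the singletons of [X] is the image of [X] under the identity. *)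
by rewrite bigcup_imset1 image_id; apply=> s _; exists s.
Qed.

Lemma supplement1_neq0 (s : assignment V D) (A : set D) v :
  A !=set0 -> supplement1 s A v !=set0.
Proof. by case=> m Am; exists (update s v m); exists m. Qed.

Lemma arrow_tassign X F v :
  choice_on X F -> arrow (tassign X F v) X (supplement X F v).
Proof. by move=> XF; apply: arrow_restrict => s /XF /supplement1_neq0. Qed.

Lemma arrow_tall X v : inhabited D -> arrow (tall X v) X (duplicate X v).
Proof.
by move=> [d]; apply: arrow_restrict => s _; apply: supplement1_neq0; exists d.
Qed.

(** The matching team [Z] serves twice: everything [tau] reaches lies in the domain of [tau'], so no
    starting point is lost, and everything in that domain is reached by [tau], so no value of [tau']
    is lost. *)
Lemma arrow_tconcat tau tau' X Y Z :
  arrow tau X Z -> arrow tau' Z Y -> arrow (tconcat tau tau') X Y.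
Proof.
move=> [<- postZ] [preZ <-]; split; apply/seteqP; split.
- by move=> s [t [u su _]]; exists u.
- move=> s [u su].
  have [t ut] : pre tau' u by rewrite preZ -postZ; exists s => //; exists u.
  by exists t; exists u.
- by move=> t [s _ [u su ut]]; exists u => //; exists t.
- move=> t [u pu ut].
  have [s ps su] : post tau u by rewrite postZ -preZ.
  by exists s; [exists t|]; exists u.
Qed.

Lemma arrow_tunion tau1 tau2 X1 X2 Y1 Y2 :
  arrow tau1 X1 Y1 -> arrow tau2 X2 Y2 ->
  arrow (tunion tau1 tau2) (X1 `|` X2) (Y1 `|` Y2).
Proof.
move=> [<- <-] [<- <-]; split; apply/seteqP; split.
- by move=> s [t [st|st]]; [left|right]; exists t.
- by move=> s [[t st]|[t st]]; exists t; [left|right].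
- by move=> t [s _ [st|st]]; [left|right]; exists s => //; exists t.
- by move=> t [[s _ st]|[s _ st]]; exists s; try exists t; by [left|right].
Qed.

(** Used to replace the unknown end teams of a transition by the ones computed from its explicit
    form. *)
Lemma arrow_inj tau X X' Y Y' :
  arrow tau X Y -> arrow tau X' Y' -> X = X' /\ Y = Y'.
Proof. by move=> [<- <-] [<- <-]. Qed.

Lemma reaches_eps X Y : reaches (@int_eps V D) X Y <-> X = Y.
Proof.
split=> [[_ [Z ->] XY]|<-]; last by exists (tid X); [exists X | exact: arrow_tid].
by have [-> ->] := arrow_inj _ _ _ _ _ XY (arrow_tid Z).
Qed.

Lemma reaches_some v X Y :
  reaches (int_some v) X Y <-> exists F, choice_on X F /\ Y = supplement X F v.
Proof.
split=> [[_ [Z [F [ZF ->]]] XY]|[F [XF ->]]].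
  by have [-> ->] := arrow_inj _ _ _ _ _ XY (arrow_tassign _ _ v ZF); exists F.
by exists (tassign X F v); [exists X, F | exact: arrow_tassign].
Qed.

Lemma reaches_some_hide v W X Y :
  reaches (int_some_hide v W) X Y <->
  exists F, [/\ choice_on X F, independent_on X W F & Y = supplement X F v].
Proof.
split=> [[_ [Z [F [ZF WF ->]]] XY]|[F [XF WF ->]]].
  by have [-> ->] := arrow_inj _ _ _ _ _ XY (arrow_tassign _ _ v ZF); exists F.
by exists (tassign X F v); [exists X, F | exact: arrow_tassign].
Qed.

Lemma reaches_all v X Y :
  inhabited D -> reaches (int_all v) X Y <-> Y = duplicate X v.
Proof.
move=> D0; split=> [[_ [Z ->] XY]|->].
  by have [-> ->] := arrow_inj _ _ _ _ _ XY (arrow_tall Z v D0).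
by exists (tall X v); [exists X | exact: arrow_tall].
Qed.

Lemma reaches_seq G G' X Y :
  reaches (int_seq G G') X Y <-> exists Z, reaches G X Z /\ reaches G' Z Y.
Proof.
split=> [[_ [tau [tau' [Gtau Gtau' eqZ ->]]] XY]|[Z [[tau Gtau XZ] [tau' Gtau' ZY]]]].
  have tauE : arrow tau (pre tau) (post tau) by [].
  have tau'E : arrow tau' (post tau) (post tau') by [].
  have [-> ->] := arrow_inj _ _ _ _ _ XY (arrow_tconcat _ _ _ _ _ tauE tau'E).
  by exists (post tau); split; [exists tau | exists tau'].
exists (tconcat tau tau'); last exact: arrow_tconcat XZ ZY.
by exists tau, tau'; split=> //; rewrite XZ.2 ZY.1.
Qed.

Lemma reaches_union G1 G2 X Y :
  reaches (int_union G1 G2) X Y <->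
  exists X1 X2 Y1 Y2,
    [/\ reaches G1 X1 Y1, reaches G2 X2 Y2, X1 `|` X2 = X & Y1 `|` Y2 = Y].
Proof.
split=> [[_ [tau1 [tau2 [G1tau G2tau ->]]] XY]|].
  (* Any transition is an arrow between its own precondition and postcondition; these supply the
     four teams. *)
  have tau1E : arrow tau1 (pre tau1) (post tau1) by [].
  have tau2E : arrow tau2 (pre tau2) (post tau2) by [].
  have [-> ->] := arrow_inj _ _ _ _ _ XY (arrow_tunion _ _ _ _ _ _ tau1E tau2E).
  exists (pre tau1), (pre tau2), (post tau1), (post tau2).
  by split=> //; [exists tau1 | exists tau2].
move=> [X1 [X2 [Y1 [Y2 [[tau1 G1tau XY1] [tau2 G2tau XY2] <- <-]]]]].
exists (tunion tau1 tau2); last exact: arrow_tunion.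
by exists tau1, tau2.
Qed.

Lemma reaches_test (S : set (team V D)) X Y :
  reaches (int_test S) X Y <-> S X /\ X = Y.
Proof.
split=> [[_ [Z [SZ ->]] XY]|[SX <-]].
  by have [-> ->] := arrow_inj _ _ _ _ _ XY (arrow_tid Z).
by exists (tid X); [exists X | exact: arrow_tid].
Qed.

(** A path of [n] steps visits [n.+1] teams, numbered from 1; the other values of [Z] are arbitrary.
    [int_seq H G] adds its step at the end, so the induction fixes [X] and lets [Y] vary. *)
Lemma reaches_iter G n X Y :
  reaches (iter n (fun H => int_seq H G) (@int_eps V D)) X Y <->
  exists Z : nat -> team V D,
    [/\ Z 1 = X, Z n.+1 = Y &
        forall i, 1 <= i < n.+1 -> reaches G (Z i) (Z i.+1)].
Proof.
elim: n Y => [|n IHn] Y.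
  rewrite reaches_eps; split=> [<-|[Z [<- <- _]] //].
  by exists (fun=> X); split=> // -[|[]].
rewrite iterS reaches_seq; split=> [[T [/IHn [Z [ZX ZT GZ]] GTY]]|[Z [ZX ZY GZ]]].
  (* Position [n.+2] lies beyond the path to [T], so overwriting it with [Y] keeps the earlier
     links; the new link, at [i = n.+1], is [GTY]. *)
  exists (fun i => if i == n.+2 then Y else Z i); split; rewrite ?eqxx //.
  move=> i /andP[i1]; rewrite ltnS leq_eqVlt => /orP[/eqP->|lt_in].
    by rewrite eqxx ltn_eqF // ZT.
  rewrite eqSS (ltn_eqF lt_in) (ltn_eqF (leqW lt_in)).
  by apply: GZ; rewrite i1.
exists (Z n.+1); split; last by rewrite -ZY; apply: GZ; rewrite ltnSn.
apply/IHn; exists Z; split=> // i /andP[i1 lt_in].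
by apply: GZ; rewrite i1 leqW.
Qed.

(** Here [n] counts teams, one more than the iterations. Without [1 <= n], the choice [n = 0] would
    only ask for [Z 1 = X] and [Z 0 = Y], which any two teams satisfy. *)
Lemma reaches_star G X Y :
  reaches (int_star G) X Y <->
  exists (n : nat) (Z : nat -> team V D),
    [/\ 1 <= n, Z 1 = X, Z n = Y &
        forall i, 1 <= i < n -> reaches G (Z i) (Z i.+1)].
Proof.
split=> [[tau [n Gtau] XY]|[[|n] [Z [// _ ZX ZY GZ]]]].
  have /reaches_iter [Z [ZX ZY GZ]] :
    reaches (iter n (fun H => int_seq H G) (@int_eps V D)) X Y by exists tau.
  by exists n.+1, Z.
have /reaches_iter [tau Gtau XY] : exists Z : nat -> team V D,
  [/\ Z 1 = X, Z n.+1 = Y &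
      forall i, 1 <= i < n.+1 -> reaches G (Z i) (Z i.+1)] by exists Z.
by exists tau => //; exists n.
Qed.

End Arrows.

Theorem theorem2 (Sg : signature) (V P : eqType) (hV : inhabited V) :
  (forall (M : model Sg) (rho : P -> M) (X Y : team V M),
    (trans_sat rho X Y GEps <-> X = Y) /\
    (forall v : V,
      trans_sat rho X Y (GSome v) <->
      exists F : assignment V M -> set M, choice_on X F /\ Y = supplement X F v) /\
    (forall (v : V) (W : set V),
      trans_sat rho X Y (GSomeHide v W) <->
      exists F : assignment V M -> set M,
        [/\ choice_on X F, independent_on X W F & Y = supplement X F v]) /\
    (forall v : V, trans_sat rho X Y (GAll v) <-> Y = duplicate X v) /\
    (forall g1 g2 : game Sg V P,
      trans_sat rho X Y (GSeq g1 g2) <->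
      exists Z : team V M, trans_sat rho X Z g1 /\ trans_sat rho Z Y g2) /\
    (forall g1 g2 : game Sg V P,
      trans_sat rho X Y (GUnion g1 g2) <->
      exists X1 X2 Y1 Y2 : team V M,
        [/\ trans_sat rho X1 Y1 g1, trans_sat rho X2 Y2 g2,
            X1 `|` X2 = X & Y1 `|` Y2 = Y]) /\
    (forall phi : belief Sg V P,
      trans_sat rho X Y (GTest phi) <-> sat rho X phi /\ X = Y) /\
    (forall g : game Sg V P,
      trans_sat rho X Y (GStar g) <->
      exists (n : nat) (Z : nat -> team V M),
        [/\ 1 <= n, Z 1 = X, Z n = Y &
            forall i : nat, 1 <= i < n -> trans_sat rho (Z i) (Z i.+1) g])) /\
  (forall (M : model Sg) (rho : P -> M) (g : game Sg V P) (phi : belief Sg V P)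
     (X : team V M),
    sat rho X (BDia g phi) <->
    exists Y : team V M, trans_sat rho X Y g /\ sat rho Y phi).
Proof.
split=> [M rho X Y|M rho g phi X].
  split; first exact: reaches_eps.
  split; first by move=> v; exact: reaches_some.
  split; first by move=> v W; exact: reaches_some_hide.
  (* A nonempty domain makes [tall X v] defined on all of [X]. *)
  split; first by move=> v; exact: reaches_all (dom_inhabited M).
  split; first by move=> g1 g2; exact: reaches_seq.
  split; first by move=> g1 g2; exact: reaches_union.
  split; first by move=> phi; exact: reaches_test.
  by move=> g; exact: reaches_star.
split=> [[tau [Y [gtau XY Yphi]]]|[Y [[tau gtau XY] Yphi]]].
  by exists Y; split=> //; exists tau.
by exists tau, Y.
Qed.
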